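(* Let $\mathrm{T}$ be a first-order theory, $\vdash$ a provability relation, $\Theta$ a set of uniqueness formulas in $(\mathrm{T},\vdash)$, and $U$ a unary predicate symbol. Assume that (i) $\mathrm{T}\vdash\forall x\,(\theta(x)\to U(x))$ for all $\theta\in\Theta$, and (ii) for every atomic formula $\varphi(x_0,\dots,x_n)$ in $n+1$ variables and all $\theta_0,\dots,\theta_n\in\Theta$, $\mathrm{T}\vdash\bar\varphi$ or $\mathrm{T}\vdash\neg\bar\varphi$, where $\bar\varphi$ is the sentence $\exists x_0\ldots\exists x_n\,(\varphi(x_0,\dots,x_n)\wedge\theta_0(x_0)\wedge\dots\wedge\theta_n(x_n))$. Then for every sentence $\sigma$, $\mathrm{T}\vdash^U_\Theta\sigma^U$ or $\mathrm{T}\vdash^U_\Theta\neg\sigma^U$.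
   Context: First-order finitary logic. A provability relation $\vdash$ is the provability of classical first-order logic or any stronger one. A formula $\theta(x)$ in one free variable is a uniqueness formula in $(\mathrm{T},\vdash)$ iff $\mathrm{T}\vdash\exists x\,(\theta(x)\wedge\forall y\,(\theta(y)\to x=y))$. For a formula $\psi$, $\psi^U$ denotes its relativization to $U$ (all quantifiers bounded to $U$). For a set $\Theta$ of uniqueness formulas, the $(\Theta,U)$-rule is the schema which, for each formula $\varphi$ in one free variable $x$, infers $(\forall x\,\varphi(x))^U$ from the premises $\{(\exists x\,(\varphi(x)\wedge\theta(x)))^U:\theta\in\Theta\}$; $\vdash^U_\Theta$ is the provability generated by $\vdash$ and the $(\Theta,U)$-rule.
   Formalization: Added, as the claim fails otherwise: T ⊢ ∀x(U(x) → (θ(x) ↔ θ^U(x))) for all θ∈Θ (each θ is absolute for U); and (ii) is also assumed for variable-free atomic sentences, which matters only when Θ is empty. *)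

(* Defs.v *)
From mathcomp Require Import all_boot.
From mathcomp Require Import boolp classical_sets.

Set Implicit Arguments.
Unset Strict Implicit.
Unset Printing Implicit Defensive.

Local Open Scope classical_set_scope.

Record language := Language {
  funsym : nat -> Type;
  relsym : nat -> Type }.

Section Syntax.
Variable L : language.

(* Well-scoped de Bruijn syntax: [term n] and [formula n] are the terms and
   formulas whose free variables are among x_i, i : 'I_n.  A quantifier binds
   the variable ord0 of its body. *)

Inductive term (n : nat) : Type :=
| Var of 'I_n
| App k of funsym L k & ('I_k -> term n).

Inductive formula : nat -> Type :=
| Fal n : formula n
| Eq n : term n -> term n -> formula n
| Rel n k : relsym L k -> ('I_k -> term n) -> formula n
| Imp n : formula n -> formula n -> formula n
| And n : formula n -> formula n -> formula n
| Or n : formula n -> formula n -> formula n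
| All n : formula n.+1 -> formula n
| Ex n : formula n.+1 -> formula n.

Definition sentence := formula 0.

Definition Neg n (p : formula n) : formula n := Imp p (Fal n).
Definition Iff n (p q : formula n) : formula n := And (Imp p q) (Imp q p).

Definition atomic n (p : formula n) : Prop :=
  match p with
  | Eq _ _ _ | Rel _ _ _ _ => True
  | _ => False
  end.

Fixpoint subst_term m n (s : 'I_m -> term n) (t : term m) : term n :=
  match t with
  | Var i => s i
  | App k f ts => App f (fun j => subst_term s (ts j))
  end.

Definition shift_term n : term n -> term n.+1 :=
  subst_term (fun i => Var (lift ord0 i)).

Definition up m n (s : 'I_m -> term n) : 'I_m.+1 -> term n.+1 := fun i =>
  if unlift ord0 i is Some j then shift_term (s j) else Var ord0.

Fixpoint subst m (p : formula m) : forall n, ('I_m -> term n) -> formula n :=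
  match p with
  | Fal _ => fun n s => Fal n
  | Eq _ t u => fun n s => Eq (subst_term s t) (subst_term s u)
  | Rel _ _ r ts => fun n s => Rel r (fun j => subst_term s (ts j))
  | Imp _ p q => fun n s => Imp (subst p s) (subst q s)
  | And _ p q => fun n s => And (subst p s) (subst q s)
  | Or _ p q => fun n s => Or (subst p s) (subst q s)
  | All _ p => fun n s => All (subst p (up s))
  | Ex _ p => fun n s => Ex (subst p (up s))
  end.

Definition shift n (p : formula n) : formula n.+1 :=
  subst p (fun i => Var (lift ord0 i)).

(* p[t], substituting t for ord0 and lowering the other variables. *)
Definition inst n (p : formula n.+1) (t : term n) : formula n :=
  subst p (fun i => if unlift ord0 i is Some j then Var j else t).

(* theta(t), for a formula in one free variable and a term in any scope. *)
Definition at_term n (theta : formula 1) (t : term n) : formula n :=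
  subst theta (fun _ => t).

Fixpoint relativize (U : relsym L 1) n (p : formula n) : formula n :=
  match p with
  | Fal n => Fal n
  | Eq _ t u => Eq t u
  | Rel _ _ r ts => Rel r ts
  | Imp _ p q => Imp (relativize U p) (relativize U q)
  | And _ p q => And (relativize U p) (relativize U q)
  | Or _ p q => Or (relativize U p) (relativize U q)
  | All _ p => All (Imp (Rel U (fun _ => Var ord0)) (relativize U p))
  | Ex _ p => Ex (And (Rel U (fun _ => Var ord0)) (relativize U p))
  end.

Fixpoint exists_closure n : formula n -> sentence :=
  match n with
  | 0 => id
  | m.+1 => fun p => exists_closure (Ex p)
  end.

(* The sentence written \bar\varphi for phi(x_0, ..., x_(n-1)):
   Ex x_(n-1) ... Ex x_0 (phi /\ theta_0(x_0) /\ ... /\ theta_(n-1)(x_(n-1))),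
   which is phi itself when n = 0. *)
Definition bar n (phi : formula n) (theta : 'I_n -> formula 1) : sentence :=
  exists_closure
    (foldl (@And n) phi [seq at_term (theta i) (Var i) | i <- enum 'I_n]).

(* Natural deduction for classical first-order logic with equality.
   [nd_inhabited] is needed because of the scoped syntax: without closed terms,
   nonemptiness of the domain is not otherwise derivable in scope 0. *)
Inductive nd : forall n, set (formula n) -> formula n -> Prop :=
| nd_ax n (G : set (formula n)) p : G p -> nd G p
| nd_raa n (G : set (formula n)) p : nd (G `|` [set Neg p]) (Fal n) -> nd G p
| nd_impI n (G : set (formula n)) p q : nd (G `|` [set p]) q -> nd G (Imp p q)
| nd_impE n (G : set (formula n)) p q : nd G (Imp p q) -> nd G p -> nd G q
| nd_andI n (G : set (formula n)) p q : nd G p -> nd G q -> nd G (And p q)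
| nd_andE1 n (G : set (formula n)) p q : nd G (And p q) -> nd G p
| nd_andE2 n (G : set (formula n)) p q : nd G (And p q) -> nd G q
| nd_orI1 n (G : set (formula n)) p q : nd G p -> nd G (Or p q)
| nd_orI2 n (G : set (formula n)) p q : nd G q -> nd G (Or p q)
| nd_orE n (G : set (formula n)) p q r : nd G (Or p q) ->
    nd (G `|` [set p]) r -> nd (G `|` [set q]) r -> nd G r
| nd_allI n (G : set (formula n)) (p : formula n.+1) :
    nd (@shift n @` G) p -> nd G (All p)
| nd_allE n (G : set (formula n)) (p : formula n.+1) t :
    nd G (All p) -> nd G (inst p t)
| nd_exI n (G : set (formula n)) (p : formula n.+1) t :
    nd G (inst p t) -> nd G (Ex p)
| nd_exE n (G : set (formula n)) (p : formula n.+1) q :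
    nd G (Ex p) -> nd ((@shift n @` G) `|` [set p]) (shift q) -> nd G q
| nd_eq_refl n (G : set (formula n)) t : nd G (Eq t t)
| nd_eq_subst n (G : set (formula n)) (p : formula n.+1) t u :
    nd G (Eq t u) -> nd G (inst p t) -> nd G (inst p u)
| nd_inhabited n (G : set (formula n)) :
    nd G (Ex (Eq (Var ord0) (Var ord0))).

Definition provability_relation (P : set sentence -> sentence -> Prop) : Prop :=
  forall (T : set sentence) (s : sentence), nd T s -> P T s.

(* The sentence Ex x (theta(x) /\ All y (theta(y) -> x = y)). *)
Definition unique_existence (theta : formula 1) : sentence :=
  Ex (And theta
    (All (Imp (at_term theta (Var ord0)) (Eq (Var ord_max) (Var ord0))))).

(* The sentences provable from T in the provability generated by P and the
   (Theta, U)-rule: the least set of sentences that contains T and is closed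
   under P-consequence and under the rule. *)
Inductive rule_provable (P : set sentence -> sentence -> Prop)
    (Theta : set (formula 1)) (U : relsym L 1) (T : set sentence) :
    sentence -> Prop :=
| rp_axiom s : T s -> rule_provable P Theta U T s
| rp_consequence (G : set sentence) s :
    (forall g, G g -> rule_provable P Theta U T g) -> P G s ->
    rule_provable P Theta U T s
| rp_rule (phi : formula 1) :
    (forall theta, Theta theta ->
      rule_provable P Theta U T (relativize U (Ex (And phi theta)))) ->
    rule_provable P Theta U T (relativize U (All phi)).

End Syntax.

Arguments Var {L n}.

(* Main.v *)
(* Let Q be the set of sentences provable with the rule, and consider contexts
   in which every free variable x_i satisfies some theta_i in Theta, on top of
   Q.  By induction on phi, each such context proves phi^U or its negation.
   Atomic formulas are the hypothesis.  For a quantifier over psi, either some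
   theta gives a named counterexample (resp. witness), or psi^U holds at every
   name, and then the rule, which is admissible in every named context, gives
   the universal statement.  The empty context gives the theorem. *)

Require Import Defs.
From mathcomp Require Import all_boot.
From mathcomp Require Import boolp classical_sets.

Set Implicit Arguments.
Unset Strict Implicit.
Unset Printing Implicit Defensive.

Local Open Scope classical_set_scope.

(** * Substitution calculus for the scoped syntax *)

Section Substitution.
Variable L : language.

(** For [s := Var] this is the substitution used by [inst], so instances and iterated instances are
    folded into it. *)
Definition scons m n (t : term L n) (s : 'I_m -> term L n) :
    'I_m.+1 -> term L n :=
  fun i => if unlift ord0 i is Some j then s j else t.

Lemma scons0 m n (t : term L n) (s : 'I_m -> term L n) : scons t s ord0 = t.
Proof. by rewrite /scons unlift_none. Qed.

Lemma sconsS m n (t : term L n) (s : 'I_m -> term L n) i :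
  scons t s (lift ord0 i) = s i.
Proof. by rewrite /scons liftK. Qed.

Lemma up0 m n (s : 'I_m -> term L n) : up s ord0 = Var ord0.
Proof. by rewrite /up unlift_none. Qed.

Lemma upS m n (s : 'I_m -> term L n) i : up s (lift ord0 i) = shift_term (s i).
Proof. by rewrite /up liftK. Qed.

Lemma eq_ordS (A : Type) m (f g : 'I_m.+1 -> A) :
  f ord0 = g ord0 -> (forall i, f (lift ord0 i) = g (lift ord0 i)) -> f = g.
Proof. by move=> fg0 fgS; apply/funext => i; case: (unliftP ord0 i) => [j|] ->. Qed.

Lemma subst_term_comp m n k (r : 'I_m -> term L n) (s : 'I_n -> term L k) t :
  subst_term s (subst_term r t) = subst_term (fun i => subst_term s (r i)) t.
Proof.
elim: t => [i //|l f ts IH] /=; congr App.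
by apply/funext => j; rewrite IH.
Qed.

Lemma subst_term_id n (t : term L n) : subst_term Var t = t.
Proof. by elim: t => [//|l f ts IH] /=; congr App; apply/funext => j; rewrite IH. Qed.

Lemma subst_shift_term m n (s : 'I_m.+1 -> term L n) (t : term L m) :
  subst_term s (shift_term t) = subst_term (fun i => s (lift ord0 i)) t.
Proof. by rewrite /shift_term subst_term_comp. Qed.

Lemma up_comp m n k (r : 'I_m -> term L n) (s : 'I_n -> term L k) :
  (fun i => subst_term (up s) (up r i)) = up (fun i => subst_term s (r i)).
Proof.
apply: eq_ordS => [|i]; first by rewrite !up0 /= up0.
rewrite !upS subst_shift_term /shift_term subst_term_comp.
by congr subst_term; apply/funext => j; rewrite upS.
Qed.

Lemma up_Var n : up (@Var L n) = Var.
Proof. by apply: eq_ordS => [|i]; rewrite ?up0 ?upS. Qed.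

Lemma subst_comp m (p : formula L m) n k (r : 'I_m -> term L n)
    (s : 'I_n -> term L k) :
  subst (subst p r) s = subst p (fun i => subst_term s (r i)).
Proof.
elim: p n k r s => {m} [m|m t u|m l R ts|m p IHp q IHq|m p IHp q IHq
  |m p IHp q IHq|m p IHp|m p IHp] n k r s //=;
  rewrite ?IHp ?IHq ?up_comp ?subst_term_comp //.
by congr Rel; apply/funext => j; rewrite subst_term_comp.
Qed.

Lemma subst_id n (p : formula L n) : subst p Var = p.
Proof.
elim: p => {n} [n|n t u|n l R ts|n p IHp q IHq|n p IHp q IHq
  |n p IHp q IHq|n p IHp|n p IHp] //=;
  rewrite ?up_Var ?IHp ?IHq ?subst_term_id //.
by congr Rel; apply/funext => j; rewrite subst_term_id.
Qed.

Lemma subst_shift m n (p : formula L m) (s : 'I_m.+1 -> term L n) :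
  subst (shift p) s = subst p (fun i => s (lift ord0 i)).
Proof. exact: subst_comp. Qed.

Lemma subst_up_shift m n (p : formula L m) (s : 'I_m -> term L n) :
  subst (shift p) (up s) = shift (subst p s).
Proof.
rewrite subst_shift /shift subst_comp; congr subst.
by apply/funext => i; rewrite upS.
Qed.

Lemma inst_up m n (p : formula L m.+1) (s : 'I_m -> term L n) t :
  inst (subst p (up s)) t = subst p (scons t s).
Proof.
rewrite /inst -/(scons t Var) subst_comp; congr subst.
apply: eq_ordS => [|i]; first by rewrite up0 scons0 /= scons0.
rewrite upS sconsS subst_shift_term -[RHS]subst_term_id.
by congr subst_term; apply/funext => j; rewrite sconsS.
Qed.

Lemma subst_inst m n (p : formula L m.+1) (s : 'I_m -> term L n) t :
  subst (inst p t) s = inst (subst p (up s)) (subst_term s t).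
Proof.
rewrite inst_up /inst -/(scons t Var) subst_comp; congr subst.
by apply: eq_ordS => [|i]; rewrite ?scons0 ?sconsS.
Qed.

(** Shifting a quantified formula frees [ord0]; opening it at that fresh variable restores the
    original body. *)
Lemma inst_up_shift n (p : formula L n.+1) :
  inst (subst p (up (fun i => Var (lift ord0 i)))) (Var ord0) = p.
Proof.
rewrite inst_up -[RHS]subst_id; congr subst.
by apply: eq_ordS => [|i]; rewrite ?scons0 ?sconsS.
Qed.

Lemma subst_at_term m n (theta : formula L 1) t (s : 'I_m -> term L n) :
  subst (at_term theta t) s = at_term theta (subst_term s t).
Proof. exact: subst_comp. Qed.

Lemma subst1E n (theta : formula L 1) (s : 'I_1 -> term L n) :
  subst theta s = at_term theta (s ord0).
Proof. by congr subst; apply/funext => i; rewrite ord1. Qed.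

Lemma at_term_id (theta : formula L 1) : at_term theta (Var ord0) = theta.
Proof. by rewrite -(subst1E theta Var) subst_id. Qed.

(** The guard added at each quantifier mentions only the bound variable [ord0], which [up] fixes. *)
Lemma relativize_subst (U : relsym L 1) m n (p : formula L m)
    (s : 'I_m -> term L n) :
  relativize U (subst p s) = subst (relativize U p) s.
Proof.
have relU k l (r : 'I_k -> term L l) :
    Rel U (fun _ => up r ord0) = Rel U (fun _ => Var ord0).
  by rewrite up0.
elim: p n s => {m} [m|m t u|m l R ts|m p IHp q IHq|m p IHp q IHq
  |m p IHp q IHq|m p IHp|m p IHp] n s //=; rewrite ?IHp ?IHq // relU //.
Qed.

Lemma relativize_at_term (U : relsym L 1) n theta (t : term L n) :
  relativize U (at_term theta t) = at_term (relativize U theta) t.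
Proof. exact: relativize_subst. Qed.

End Substitution.

(** * Structural and derived rules of natural deduction *)

Section NaturalDeduction.
Variable L : language.
Implicit Types n : nat.

Lemma nd_weaken n (G H : set (formula L n)) p : G `<=` H -> nd G p -> nd H p.
Proof.
move=> sGH d; elim: d H sGH => {n G p}.
- by move=> n G p Gp H sGH; apply/nd_ax/sGH.
- by move=> n G p _ IH H sGH; apply/nd_raa/IH/setSU.
- by move=> n G p q _ IH H sGH; apply/nd_impI/IH/setSU.
- by move=> n G p q _ IHp _ IHq H sGH; apply: nd_impE (IHp _ sGH) (IHq _ sGH).
- by move=> n G p q _ IHp _ IHq H sGH; apply: nd_andI (IHp _ sGH) (IHq _ sGH).
- by move=> n G p q _ IH H sGH; apply: nd_andE1 (IH _ sGH).
- by move=> n G p q _ IH H sGH; apply: nd_andE2 (IH _ sGH).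
- by move=> n G p q _ IH H sGH; apply: nd_orI1 (IH _ sGH).
- by move=> n G p q _ IH H sGH; apply: nd_orI2 (IH _ sGH).
- move=> n G p q r _ IH _ IHp _ IHq H sGH.
  by apply: nd_orE (IH _ sGH) (IHp _ _) (IHq _ _); apply: setSU.
- by move=> n G p _ IH H sGH; apply/nd_allI/IH/image_subset.
- by move=> n G p t _ IH H sGH; apply/nd_allE/IH.
- by move=> n G p t _ IH H sGH; apply: nd_exI (IH _ sGH).
- move=> n G p q _ IHp _ IHq H sGH.
  by apply: nd_exE (IHp _ sGH) (IHq _ _); apply/setSU/image_subset.
- by move=> n G t H _; apply: nd_eq_refl.
- by move=> n G p t u _ IHe _ IHp H sGH; apply: nd_eq_subst (IHe _ sGH) (IHp _ sGH).
- by move=> n G H _; apply: nd_inhabited.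
Qed.

Let substs m n (s : 'I_m -> term L n) (G : set (formula L m)) :=
  (fun q => subst q s) @` G.

Let substsU1 m n (s : 'I_m -> term L n) (G : set (formula L m)) p :
  substs s (G `|` [set p]) = substs s G `|` [set subst p s].
Proof. by rewrite /substs image_setU image_set1. Qed.

Let substs_shift m n (s : 'I_m -> term L n) (G : set (formula L m)) :
  substs (up s) (@shift L m @` G) = @shift L n @` substs s G.
Proof.
rewrite /substs !image_comp; congr (_ @` G); apply/funext => q /=.
exact: subst_up_shift.
Qed.

(** Induction on the derivation passes the quantifier rules because [up s] applied to a shifted
    context is the shift of the image under [s]. *)
Lemma nd_subst m (G : set (formula L m)) p n (s : 'I_m -> term L n) :
  nd G p -> nd ((fun q => subst q s) @` G) (subst p s).
Proof.
rewrite -/(substs s G) => d; elim: d n s => {m G p}.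
- by move=> m G p Gp n s; apply: nd_ax; exists p.
- by move=> m G p _ IH n s; apply: nd_raa; rewrite -(substsU1 s G (Neg p)); apply: IH.
- by move=> m G p q _ IH n s; apply: nd_impI; rewrite -substsU1; apply: IH.
- by move=> m G p q _ IHp _ IHq n s; apply: nd_impE (IHp n s) (IHq n s).
- by move=> m G p q _ IHp _ IHq n s; apply: nd_andI (IHp n s) (IHq n s).
- by move=> m G p q _ IH n s; apply: nd_andE1 (IH n s).
- by move=> m G p q _ IH n s; apply: nd_andE2 (IH n s).
- by move=> m G p q _ IH n s; apply: nd_orI1 (IH n s).
- by move=> m G p q _ IH n s; apply: nd_orI2 (IH n s).
- move=> m G p q r _ IH _ IHp _ IHq n s.
  apply: (nd_orE (p := subst p s) (q := subst q s) (IH n s)).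
    by rewrite -substsU1; apply: IHp.
  by rewrite -substsU1; apply: IHq.
- by move=> m G p _ IH n s; apply: nd_allI; rewrite -substs_shift; apply: IH.
- by move=> m G p t _ IH n s; rewrite subst_inst; apply/nd_allE/IH.
- move=> m G p t _ IH n s /=; apply: (nd_exI (t := subst_term s t)).
  by rewrite -subst_inst; apply: IH.
- move=> m G p q _ IHp _ IHq n s; apply: nd_exE (IHp n s) _.
  by rewrite -substs_shift -substsU1 -subst_up_shift; apply: IHq.
- by move=> m G t n s; apply: nd_eq_refl.
- move=> m G p t u _ IHe _ IHp n s; rewrite subst_inst.
  by apply: nd_eq_subst (IHe n s) _; rewrite -subst_inst; apply: IHp.
- by move=> m G n s /=; rewrite up0; apply: nd_inhabited.
Qed.

Lemma nd_shift n (G : set (formula L n)) p :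
  nd G p -> nd (@shift L n @` G) (shift p).
Proof. exact: nd_subst. Qed.

Lemma nd_shiftU n (G : set (formula L n)) H p :
  nd G p -> nd ((@shift L n @` G) `|` H) (shift p).
Proof. by move=> /nd_shift; apply: nd_weaken; apply: subsetUl. Qed.

Lemma nd_weakenU n (G H : set (formula L n)) p : nd G p -> nd (G `|` H) p.
Proof. by apply: nd_weaken; apply: subsetUl. Qed.

Lemma nd_last n (G : set (formula L n)) p : nd (G `|` [set p]) p.
Proof. by apply: nd_ax; right. Qed.

Lemma nd_cut n (G : set (formula L n)) p q :
  nd G p -> nd (G `|` [set p]) q -> nd G q.
Proof. by move=> dp /nd_impI dq; apply: nd_impE dq dp. Qed.

Lemma nd_exfalso n (G : set (formula L n)) p : nd G (Fal L n) -> nd G p.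
Proof. by move=> d; apply/nd_raa/nd_weakenU. Qed.

Lemma nd_allE_up m n (G : set (formula L n)) (p : formula L m.+1) s t :
  nd G (subst (All p) s) -> nd G (subst p (scons t s)).
Proof. by move=> d; rewrite -inst_up; apply: nd_allE. Qed.

(** Keeping the substitution explicit allows two nested quantifiers of a shifted formula to be
    opened without computing the lifts. *)
Lemma nd_all_imp_allE m n (G : set (formula L n)) (a : formula L m.+1)
    (b : formula L m.+2) s t u :
  nd G (subst (All (Imp a (All b))) s) -> nd G (subst a (scons t s)) ->
  nd G (subst b (scons u (scons t s))).
Proof.
by move=> /(nd_allE_up t) /= /nd_impE d /d /(nd_allE u); rewrite inst_up.
Qed.

Lemma nd_allE_shift n (G : set (formula L n.+1)) (p : formula L n.+1) :
  nd G (shift (All p)) -> nd G p.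
Proof. by move=> d; rewrite -[p]inst_up_shift; apply: nd_allE. Qed.

Lemma nd_exI_shift n (G : set (formula L n.+1)) (p : formula L n.+1) :
  nd G p -> nd G (shift (Ex p)).
Proof. by rewrite -{1}[p]inst_up_shift; apply: nd_exI. Qed.

Lemma subst_unique_existence n theta (e : 'I_0 -> term L n) :
  subst (unique_existence theta) e =
  Ex (And (at_term theta (Var ord0))
    (All (Imp (at_term theta (Var ord0)) (Eq (Var (lift ord0 ord0)) (Var ord0))))).
Proof.
rewrite /= subst1E subst_at_term /= !up0.
(* In ['I_2], [ord_max] is the outer variable, that is, the successor of [ord0]. *)
by rewrite (_ : ord_max = lift ord0 ord0) ?upS ?up0 //; apply: val_inj.
Qed.

Lemma nd_ex_at n (G : set (formula L n)) theta (e : 'I_0 -> term L n) :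
  nd G (subst (unique_existence theta) e) -> nd G (Ex (at_term theta (Var ord0))).
Proof.
rewrite subst_unique_existence => d; apply: nd_exE d _; apply: nd_exI_shift.
exact/nd_andE1/nd_last.
Qed.

Lemma nd_eq_sym n (G : set (formula L n)) t u : nd G (Eq t u) -> nd G (Eq u t).
Proof.
(* Leibniz's rule is applied to the predicate [x = t], whose instance at [t] is reflexivity. *)
have E v : inst (Eq (Var ord0) (shift_term t)) v = Eq v t.
  rewrite /inst -/(scons v Var) /= scons0 subst_shift_term.
  rewrite -[in RHS](subst_term_id t); congr (Eq _ (subst_term _ _)).
  by apply/funext => i; rewrite sconsS.
by move=> d; rewrite -E; apply: nd_eq_subst d _; rewrite E; apply: nd_eq_refl.
Qed.

Lemma nd_eq_trans n (G : set (formula L n)) t u v :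
  nd G (Eq t u) -> nd G (Eq u v) -> nd G (Eq t v).
Proof.
have E w : inst (Eq (shift_term t) (Var ord0)) w = Eq t w.
  rewrite /inst -/(scons w Var) /= scons0 subst_shift_term.
  rewrite -[in RHS](subst_term_id t); congr (Eq (subst_term _ _) _).
  by apply/funext => i; rewrite sconsS.
by move=> dtu duv; rewrite -E; apply: nd_eq_subst duv _; rewrite E.
Qed.

Lemma nd_unique_eq n (G : set (formula L n)) theta (e : 'I_0 -> term L n) t u :
  nd G (subst (unique_existence theta) e) ->
  nd G (at_term theta t) -> nd G (at_term theta u) -> nd G (Eq t u).
Proof.
rewrite subst_unique_existence => d dt du; apply: nd_exE d _.
set B := And _ _; set H := _ `|` _.
(* The witness [ord0] of unique existence equals every term satisfying [theta], hence both [t] and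
   [u]. *)
have dH v : nd G (at_term theta v) -> nd H (Eq (Var ord0) (shift_term v)).
  move=> dv; have /nd_andE2 : nd H B := nd_last _ _.
  move=> /(nd_allE (shift_term v)).
  rewrite /inst -/(scons _ _) /= subst_at_term /= sconsS scons0 => /nd_impE; apply.
  by rewrite -subst_at_term; apply: nd_shiftU.
by apply: nd_eq_trans (dH _ du); apply/nd_eq_sym/dH.
Qed.

End NaturalDeduction.

(** * Contexts over the theory generated by the rule *)

Section Decision.
Variables (L : language) (T : set (sentence L)).
Variables (P : set (sentence L) -> sentence L -> Prop).
Variables (Theta : set (formula L 1)) (U : relsym L 1).
Hypothesis P_provability : provability_relation P.
Hypothesis Theta_unique : forall theta : formula L 1, Theta theta ->
  P T (unique_existence theta).
Hypothesis Theta_in_U : forall theta : formula L 1, Theta theta ->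
  P T (All (Imp theta (Rel U (fun _ => Var ord0)))).
(** An assumption in addition to (i) and (ii). The premises of the rule contain theta^U, whereas
    names are given by theta; on elements of U the two become interchangeable. *)
Hypothesis Theta_absolute : forall theta : formula L 1, Theta theta ->
  P T (All (Imp (Rel U (fun _ => Var ord0)) (Iff theta (relativize U theta)))).
Hypothesis atomic_decided : forall (n : nat) (phi : formula L n)
  (theta : 'I_n -> formula L 1),
  atomic phi -> (forall i : 'I_n, Theta (theta i)) ->
  P T (bar phi theta) \/ P T (Neg (bar phi theta)).

Let Q : set (sentence L) := rule_provable P Theta U T.

Lemma rule_provable_P s : P T s -> Q s.
Proof. exact/rp_consequence/rp_axiom. Qed.

(** [P] relates sentences only, so reasoning with free variables takes place in [nd] over [Q];
    closed conclusions return to [Q] here. *)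
Lemma rule_provable_nd s : nd Q s -> Q s.
Proof. by move=> /P_provability; apply: rp_consequence. Qed.

(** Sentences enter scope [n] by the empty substitution. Quantifying over [e] lets any presentation
    of it be used. *)
Definition over_theory n (G : set (formula L n)) :=
  forall (s : sentence L) (e : 'I_0 -> term L n), Q s -> nd G (subst s e).

Lemma over_theory_sub n (G H : set (formula L n)) :
  G `<=` H -> over_theory G -> over_theory H.
Proof. by move=> sGH oG s e Qs; apply: nd_weaken sGH (oG s e Qs). Qed.

Let closed_subst n : 'I_0 -> term L n := fun i => Var (widen_ord (leq0n n) i).

Lemma over_theory_shift n (G : set (formula L n)) :
  over_theory G -> over_theory (@shift L n @` G).
Proof.
move=> oG s e Qs; have -> : subst s e = shift (subst s (@closed_subst n)).
  by rewrite /shift subst_comp; congr subst; apply/funext => -[].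
exact/nd_shift/oG.
Qed.

Lemma over_theory_shiftU n (G : set (formula L n)) H :
  over_theory G -> over_theory ((@shift L n @` G) `|` H).
Proof. by move=> /over_theory_shift; apply: over_theory_sub; apply: subsetUl. Qed.

Lemma nd_theta_exists n (G : set (formula L n)) theta :
  over_theory G -> Theta theta -> nd G (Ex (at_term theta (Var ord0))).
Proof.
move=> oG Tt; apply: (nd_ex_at (e := @closed_subst n)).
exact/oG/rule_provable_P/Theta_unique.
Qed.

Lemma nd_theta_eq n (G : set (formula L n)) theta t u :
  over_theory G -> Theta theta ->
  nd G (at_term theta t) -> nd G (at_term theta u) -> nd G (Eq t u).
Proof.
move=> oG Tt; apply: (nd_unique_eq (e := @closed_subst n)).
exact/oG/rule_provable_P/Theta_unique.
Qed.

Lemma nd_theta_U n (G : set (formula L n)) theta t :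
  over_theory G -> Theta theta ->
  nd G (at_term theta t) -> nd G (Rel U (fun _ => t)).
Proof.
move=> oG Tt; have /rule_provable_P /(oG _ (@closed_subst n)) := Theta_in_U Tt.
by move=> /(nd_allE_up t) /=; rewrite subst1E scons0; apply: nd_impE.
Qed.

Lemma nd_theta_absolute n (G : set (formula L n)) theta t :
  over_theory G -> Theta theta -> nd G (Rel U (fun _ => t)) ->
  nd G (Iff (at_term theta t) (relativize U (at_term theta t))).
Proof.
move=> oG Tt; have /rule_provable_P /(oG _ (@closed_subst n)) := Theta_absolute Tt.
move=> /(nd_allE_up t) /=.
by rewrite !subst1E scons0 -relativize_at_term; apply: nd_impE.
Qed.

(** * Named contexts and the rule with parameters *)

Definition name_ext n (G : set (formula L n)) theta : set (formula L n.+1) :=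
  (@shift L n @` G) `|` [set at_term theta (Var ord0)].

(* Named contexts: the theory Q extended by variables, each one asserted to be
   the element defined by some theta in Theta. *)
Inductive named : forall n, set (formula L n) -> Prop :=
| named_theory : named Q
| named_ext n (G : set (formula L n)) theta :
    Theta theta -> named G -> named (name_ext G theta).

Lemma named_over_theory n (G : set (formula L n)) : named G -> over_theory G.
Proof.
elim=> {n G} [s e Qs|n G theta _ _ oG]; last exact: over_theory_shiftU.
rewrite (_ : e = Var) ?subst_id; first exact: nd_ax.
by apply/funext => -[].
Qed.

Lemma nd_name n (G : set (formula L n)) theta :
  nd (name_ext G theta) (at_term theta (Var ord0)).
Proof. exact: nd_last. Qed.

Let swap n : 'I_n.+2 -> term L n.+2 :=
  scons (Var (lift ord0 ord0))
    (scons (Var ord0) (fun i => Var (lift ord0 (lift ord0 i)))).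

(** The naming formulas have no parameters, so the order in which two elements are named is
    immaterial up to exchanging their variables. *)
Lemma nd_swap n (G : set (formula L n)) theta0 theta1 p :
  nd (name_ext (name_ext G theta0) theta1) p ->
  nd (name_ext (name_ext G theta1) theta0) (subst p (@swap n)).
Proof.
move=> /(nd_subst (@swap n)); apply: nd_weaken => _ [_ [[q [[r Gr <-]|->] <-]|->] <-].
- left; exists (shift r); first by left; exists r.
  rewrite !subst_shift /shift subst_comp; congr subst.
  by apply/funext => i; rewrite /= /swap !sconsS.
- by right; rewrite /shift !subst_at_term /= /swap sconsS scons0.
- left; exists (at_term theta1 (Var ord0)); first by right.
  by rewrite /shift !subst_at_term /= /swap scons0.
Qed.

(* The rule has no parameters.  A parameter named by theta0 is removed by passing
   to [forall y, theta0(y) -> psi(x, y)], in which x has become the variable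
   ord0; absoluteness of theta0 allows this formula to be relativized. *)
Lemma named_rule n (G : set (formula L n)) (psi : formula L n.+1) :
  named G ->
  (forall theta, Theta theta -> nd (name_ext G theta) (relativize U psi)) ->
  nd G (relativize U (All psi)).
Proof.
move=> nG; elim: nG psi => {n G} [|n G theta0 Tt0 nG IH] psi dpsi.
  (* Here [psi] has only one free variable, so the rule itself applies. The element named by [theta]
     witnesses each premise: it lies in U, satisfies psi^U by [dpsi], and theta^U by
     absoluteness. *)
  apply/nd_ax/rp_rule => theta Tt; apply: rule_provable_nd.
  have oQ := named_over_theory named_theory.
  apply: nd_exE (nd_theta_exists oQ Tt) _; rewrite -/(name_ext Q theta).
  have oQ' := named_over_theory (named_ext Tt named_theory).
  have dU := nd_theta_U oQ' Tt (nd_name Q theta).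
  apply: nd_exI_shift; apply: (nd_andI dU) => /=; apply: nd_andI; first exact: dpsi.
  rewrite -{2}(at_term_id theta).
  by have /nd_andE1 /nd_impE := nd_theta_absolute oQ' Tt dU; apply; apply: nd_name.
set psi' := All (Imp (at_term theta0 (Var ord0)) (subst psi (@swap n))).
have /IH dpsi' theta : Theta theta -> nd (name_ext G theta) (relativize U psi').
  move=> Tt /=; apply: nd_allI; apply: nd_impI; apply: nd_impI; set H := _ `|` _.
  have oH : over_theory H.
    apply: over_theory_sub (@subsetUl _ _ _) _.
    exact/over_theory_shiftU/named_over_theory/named_ext.
  have dU : nd H (Rel U (fun _ => Var ord0)) by apply/nd_weakenU/nd_last.
  have /nd_andE2 /nd_impE := nd_theta_absolute oH Tt0 dU.
  move=> /(_ (nd_last _ _)) dt0.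
  (* Once theta0(y) is recovered from its relativization, the context includes the one naming first
     x, then y, and [dpsi] applies with the two variables exchanged. *)
  apply: nd_cut dt0 _; rewrite relativize_subst.
  apply: nd_weaken (nd_swap (dpsi _ Tt)).
  by apply: setSU => q Gq; left; left.
apply: nd_allI; apply: nd_impI; set H := _ `|` _.
have oH : over_theory H.
  exact/over_theory_shiftU/named_over_theory/named_ext.
have dt0 : nd H (at_term theta0 (Var (lift ord0 ord0))).
  rewrite -[at_term _ _](subst_at_term _ (Var ord0) (fun i => Var (lift ord0 i))).
  exact/nd_shiftU/nd_name.
have dU0 := nd_theta_U oH Tt0 dt0.
have /nd_andE1 /nd_impE := nd_theta_absolute oH Tt0 dU0.
move=> /(_ dt0) dt0U.
have : nd H (shift (shift (relativize U (All psi')))) by exact/nd_shiftU/nd_shiftU.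
move: dt0U; rewrite [shift _]subst_comp /psi'.
rewrite [relativize _ (All _)]/= !relativize_at_term relativize_subst.
rewrite -/(relativize U psi); move: (relativize U psi) => A dt0U.
(* The universal statement over [G] is opened with x as [ord0] and y as the parameter named by
   [theta0]. *)
move=> /(nd_all_imp_allE (t := Var ord0) (Var (lift ord0 ord0))) /=.
rewrite scons0 => /(_ (nd_last _ _)); rewrite !subst_at_term /= !scons0.
move=> /nd_impE /(_ dU0) /nd_impE /(_ dt0U).
rewrite subst_comp; set r := (X in subst A X).
(* Opening the two quantifiers in this order exchanges the variables again, so [r] is [swap]
   composed with itself. *)
have -> : r = Var; last by rewrite subst_id.
apply: eq_ordS => [|i]; last case: (unliftP ord0 i) => [j|] ->;
  by rewrite /r /swap ?(scons0, sconsS) /= ?(scons0, sconsS).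
Qed.

(** * Removing the quantifiers of [bar]; atomic formulas *)

Let ands n (phi : formula L n) s := foldl (@And L n) phi s.

Lemma nd_andsE n (G : set (formula L n)) phi s :
  nd G (ands phi s) -> nd G phi.
Proof. by elim: s phi => [//|p s IH] phi /IH /nd_andE1. Qed.

Lemma nd_andsE_nth n (G : set (formula L n)) phi (I : eqType)
    (f : I -> formula L n) s i :
  i \in s -> nd G (ands phi [seq f j | j <- s]) -> nd G (f i).
Proof.
elim: s phi => [//|j s IH] phi; rewrite inE => /orP[/eqP ->|].
  by move=> /(nd_andsE (phi := And _ _)) /nd_andE2.
by move=> /IH; apply.
Qed.

Lemma nd_andsI n (G : set (formula L n)) phi (I : Type) (f : I -> formula L n) s :
  nd G phi -> (forall i, nd G (f i)) -> nd G (ands phi [seq f j | j <- s]).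
Proof.
move=> dphi df; elim: s phi dphi => [//|j s IH] phi dphi.
by apply: IH; apply: nd_andI.
Qed.

(* The condition on p lets the existential quantifiers of the closure be removed
   one at a time: it makes a witness of x_i equal to the element named theta_i. *)
Lemma named_closure n (G : set (formula L n)) : named G ->
  exists theta : 'I_n -> formula L 1,
    [/\ forall i, Theta (theta i),
        forall i, nd G (at_term (theta i) (Var i)) &
        forall p, (forall i, nd [set p] (at_term (theta i) (Var i))) ->
          (Q (exists_closure p) -> nd G p) /\
          (Q (Neg (exists_closure p)) -> nd G (Neg p))].
Proof.
elim=> {n G} [|n G theta0 Tt0 nG [theta [Tt dt IH]]].
  (* In scope 0 there are no indices, so [Fal] is a dummy value, and the closure is the identity. *)
  exists (fun _ => Fal L 1); split=> [[] //|[] //|p _].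
  by split; apply: nd_ax.
pose theta' i := if unlift ord0 i is Some j then theta j else theta0.
have theta'0 : theta' ord0 = theta0 by rewrite /theta' unlift_none.
have theta'S i : theta' (lift ord0 i) = theta i by rewrite /theta' liftK.
have shift_at t u : shift (at_term u t) = at_term u (shift_term t) :> formula L n.+1.
  exact: subst_at_term.
have oG := named_over_theory (named_ext Tt0 nG).
exists theta'; split=> [i|i|p dp].
- by case: (unliftP ord0 i) => [j|] ->; rewrite ?theta'S ?theta'0.
- case: (unliftP ord0 i) => [j|] ->; rewrite ?theta'S ?theta'0; last exact: nd_name.
  by rewrite -[at_term _ _](shift_at (Var j)); apply: nd_shiftU.
(* The closure of [p] is that of [Ex p], and [Ex p] inherits the condition: the other variables keep
   their names under the witness. *)
have [|IHp IHn] := IH (Ex p).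
  move=> i; apply: nd_exE (nd_ax (erefl : [set Ex p] (Ex p))) _.
  rewrite shift_at -theta'S; apply: nd_weaken (dp _).
  exact: subsetUr.
split=> [/IHp dE|/IHn dN].
  have dE' : nd (name_ext G theta0) (shift (Ex p)) by exact: nd_shiftU.
  (* In [p'] the witness is [ord0], and the named element, now [lift ord0 ord0], does not occur.
     Both satisfy [theta0], the witness by [dp ord0], so they are equal. *)
  pose p' := subst p (up (fun i => Var (lift ord0 i))).
  apply: (nd_exE (p := p') dE'); set H := _ `|` _.
  have oH : over_theory H by exact: over_theory_shiftU.
  have dt0 : nd H (at_term theta0 (Var ord0)).
    have := dp ord0; rewrite theta'0 => /(nd_subst (up (fun i => Var (lift ord0 i)))).
    rewrite image_set1 subst_at_term /= up0.
    by apply: nd_weaken; apply: subsetUr.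
  have dt1 : nd H (at_term theta0 (Var (lift ord0 ord0))).
    rewrite -[at_term _ _](subst_at_term _ (Var ord0) (fun i => Var (lift ord0 i))).
    exact/nd_shiftU/nd_name.
  (* [A] turns the variable [ord0] of [p] into a hole for Leibniz's rule: filled with the witness it
     is [p'], filled with the named element it is [shift p]. *)
  pose A : formula L n.+3 := subst p
    (scons (Var ord0) (fun i => Var (lift ord0 (lift ord0 (lift ord0 i))))).
  have instA t : inst A t = subst p (scons t (fun i => Var (lift ord0 (lift ord0 i)))).
    rewrite /inst -/(scons t Var) subst_comp; congr subst.
    by apply: eq_ordS => [|i]; rewrite ?scons0 ?sconsS /= ?scons0 ?sconsS.
  have -> : shift p = inst A (Var (lift ord0 ord0)).
    by rewrite instA; congr subst; apply: eq_ordS => [|i]; rewrite ?scons0 ?sconsS.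
  apply: nd_eq_subst (nd_theta_eq oH Tt0 dt0 dt1) _.
  rewrite instA (_ : subst _ _ = p'); first exact: nd_last.
  by congr subst; apply: eq_ordS => [|i]; rewrite ?scons0 ?sconsS ?up0 ?upS.
apply: nd_impI; apply: nd_impE (nd_weakenU _ (nd_shiftU _ dN)) _.
exact/nd_exI_shift/nd_last.
Qed.

(** Hypothesis (ii) decides [bar phi theta] for the tuple of names, and [named_closure] carries the
    decision to the conjunction under its quantifiers. As [G] proves every theta_i(x_i), that
    conjunction is equivalent to [phi] there. *)
Lemma named_atomic n (G : set (formula L n)) phi : named G -> atomic phi ->
  nd G phi \/ nd G (Neg phi).
Proof.
move=> nG aphi; have [theta [Tt dt bar_nd]] := named_closure nG.
have [|pos neg] := bar_nd (ands phi [seq at_term (theta i) (Var i) | i <- enum 'I_n]).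
  move=> i.
  apply: (nd_andsE_nth (phi := phi)
    (f := fun i => at_term (theta i) (Var i)) (mem_enum 'I_n i)).
  exact: nd_ax.
have [/rule_provable_P /pos dp|/rule_provable_P /neg dN] := atomic_decided aphi Tt.
  by left; apply: nd_andsE dp.
right; apply: nd_impI; apply: nd_impE (nd_weakenU _ dN) _.
by apply: nd_andsI => [|i]; [apply: nd_last|apply: nd_weakenU].
Qed.

(** * Deciding relativized formulas *)

Lemma named_decided n (phi : formula L n) (G : set (formula L n)) : named G ->
  nd G (relativize U phi) \/ nd G (Neg (relativize U phi)).
Proof.
elim: phi G => {n} [n|n t u|n k r ts|n p IHp q IHq|n p IHp q IHq|n p IHp q IHq
  |n p IHp|n p IHp] G nG.
- by right; apply/nd_impI/nd_last.
- exact: named_atomic.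
- exact: named_atomic.
- have [dq|dNq] := IHq G nG; first by left; apply/nd_impI/nd_weakenU.
  have [dp|dNp] := IHp G nG.
    right; apply: nd_impI; apply: nd_impE (nd_weakenU _ dNq) _.
    exact: nd_impE (nd_last _ _) (nd_weakenU _ dp).
  left; apply: nd_impI; apply: nd_exfalso.
  exact: nd_impE (nd_weakenU _ dNp) (nd_last _ _).
- have [dp|dNp] := IHp G nG; last first.
    right; apply: nd_impI; apply: nd_impE (nd_weakenU _ dNp) _.
    exact: nd_andE1 (nd_last _ _).
  have [dq|dNq] := IHq G nG; first by left; apply: nd_andI.
  right; apply: nd_impI; apply: nd_impE (nd_weakenU _ dNq) _.
  exact: nd_andE2 (nd_last _ _).
- have [dp|dNp] := IHp G nG; first by left; apply: nd_orI1.
  have [dq|dNq] := IHq G nG; first by left; apply: nd_orI2.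
  right; apply: nd_impI; apply: nd_orE (nd_last _ _) _ _.
    exact: nd_impE (nd_weakenU _ (nd_weakenU _ dNp)) (nd_last _ _).
  exact: nd_impE (nd_weakenU _ (nd_weakenU _ dNq)) (nd_last _ _).
(* A named counterexample exists and lies in U, so it refutes the universal formula. If there is
   none, the induction hypothesis proves the body at every name, as [named_rule] requires. *)
- have [[theta Tt dN]|no_counterexample] := pselect
    (exists2 theta, Theta theta & nd (name_ext G theta) (Neg (relativize U p))).
    right; apply: nd_exE (nd_theta_exists (named_over_theory nG) Tt) _.
    rewrite -/(name_ext G theta) [shift _]/=; apply: nd_impI.
    have oG := named_over_theory (named_ext Tt nG).
    apply: nd_impE (nd_weakenU _ dN) _.
    have /nd_impE := nd_allE_shift
      (nd_last (name_ext G theta) (shift (relativize U (All p)))).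
    by apply; apply: nd_weakenU; apply: nd_theta_U oG Tt (nd_name _ _).
  left; apply: named_rule => // theta Tt.
  have [//|dN] := IHp _ (named_ext Tt nG).
  by case: no_counterexample; exists theta.
- have [[theta Tt dp]|no_witness] := pselect
    (exists2 theta, Theta theta & nd (name_ext G theta) (relativize U p)).
    left; apply: nd_exE (nd_theta_exists (named_over_theory nG) Tt) _.
    have oG := named_over_theory (named_ext Tt nG).
    apply: nd_exI_shift; apply: nd_andI dp.
    by apply: nd_theta_U oG Tt (nd_name _ _).
  (* With no named witness, every name refutes the body, so the rule is applied to its negation. *)
  have dN : nd G (relativize U (All (Neg p))).
    apply: named_rule => // theta Tt.
    have [dp|//] := IHp _ (named_ext Tt nG).
    by case: no_witness; exists theta.
  right; apply: nd_impI; apply: nd_exE (nd_last _ _) _.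
  set H := _ `|` _; have dE : nd H (And (Rel U (fun _ => Var ord0)) (relativize U p)).
    exact: nd_last.
  have /nd_allE_shift dN' : nd H (shift (relativize U (All (Neg p)))).
    exact/nd_shiftU/nd_weakenU.
  exact: nd_impE (nd_impE dN' (nd_andE1 dE)) (nd_andE2 dE).
Qed.

Lemma rule_provable_decided (sigma : sentence L) :
  Q (relativize U sigma) \/ Q (Neg (relativize U sigma)).
Proof.
by have [] := named_decided sigma named_theory => /rule_provable_nd; [left|right].
Qed.

End Decision.

Theorem theorem3 (L : language) (T : set (sentence L))
    (P : set (sentence L) -> sentence L -> Prop)
    (Theta : set (formula L 1)) (U : relsym L 1)
    (P_provability : provability_relation P)
    (Theta_unique : forall theta : formula L 1, Theta theta ->
      P T (unique_existence theta))
    (Theta_in_U : forall theta : formula L 1, Theta theta ->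
      P T (All (Imp theta (Rel U (fun _ => Var ord0)))))
    (Theta_absolute : forall theta : formula L 1, Theta theta ->
      P T (All (Imp (Rel U (fun _ => Var ord0))
                    (Iff theta (relativize U theta)))))
    (atomic_decided : forall (n : nat) (phi : formula L n)
      (theta : 'I_n -> formula L 1),
      atomic phi -> (forall i : 'I_n, Theta (theta i)) ->
      P T (bar phi theta) \/ P T (Neg (bar phi theta)))
    (sigma : sentence L) :
  rule_provable P Theta U T (relativize U sigma) \/
  rule_provable P Theta U T (Neg (relativize U sigma)).
Proof. exact: rule_provable_decided. Qed.
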